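(* Let $m\ge 1$ and $r\ge 1$ be integers and let $Q:\mathcal{S}^m\to\mathbb{R}$ be a polynomial function of the entries of a real symmetric $m\times m$ matrix. Then the graph of the function $$\mathbb{R}^{m\times r}\to\mathbb{R},\qquad v\mapsto Q(vv^\top),$$ is a semialgebraic set, and thus tame (i.e. definable in a tame structure).
   Context: $\mathcal{S}^m$ is the space of real symmetric $m\times m$ matrices; $\mathbb{R}^{m\times r}$ is identified with $\mathbb{R}^{mr}$. The function $Q(vv^\top)$ is the objective obtained by substituting the factorization $X=vv^\top$ into the problem $\inf_X Q(X)$ subject to $X\succeq0$, $\mathrm{Tr}(X)=1$. A subset of $\mathbb{R}^n$ is semialgebraic if it is a finite union of finite intersections of sets of the form $\{x\in\mathbb{R}^n: p(x)\star 0\}$ with $p$ a real polynomial and $\star\in\{>,<,=\}$. An $\mathbb{R}$-structure $S$ is a collection $\{S^p\}_{p\ge1}$, where each $S^p$ is a set of subsets of $\mathbb{R}^p$, such that: (A1) $S^p$ contains the zero sets of all finite collections of real polynomials in $p$ variables; (A2) for every linear map $L:\mathbb{R}^p\to\mathbb{R}$, the set $\{x\in\mathbb{R}^p: L(x)\ge0\}$ belongs to $S^p$; (P1) each $S^p$ is closed under (finite) unions, intersections and complements; (P2) if $X\in S^p$ and $Y\in S^q$ then $X\times Y\in S^{p+q}$; (P3) if $T:\mathbb{R}^p\to\mathbb{R}^q$ is affine and $X\in S^p$ then $T(X)\in S^q$. An $\mathbb{R}$-structure $S$ is a tame structure (o-minimal structure) if every $X\in S^1$ is a finite union of singletons and open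 intervals $(a,b)$ with $-\infty\le a<b\le\infty$. A set is definable in a tame structure (tame) if it belongs to $S^p$ for some $p$ and some tame structure $S$. *)

(* Defs.v *)
From mathcomp Require Import all_boot all_order all_algebra.
From mathcomp Require Import sesquilinear mpoly.
From mathcomp Require Import boolp classical_sets reals constructive_ereal.

Set Implicit Arguments.
Unset Strict Implicit.
Unset Printing Implicit Defensive.

Import Order.TTheory GRing.Theory Num.Theory.

Local Open Scope ring_scope.
Local Open Scope classical_set_scope.

Definition eval_at (R : realType) (n : nat) (f : {mpoly R[n]}) (x : 'rV[R]_n) : R :=
  f.@[fun i => x 0 i].

Definition sign_set (R : realType) (n : nat) (A : set 'rV[R]_n) : Prop :=
  exists f : {mpoly R[n]},
    [\/ A = [set x | eval_at f x > 0],
        A = [set x | eval_at f x < 0] |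
        A = [set x | eval_at f x = 0]].

Definition semialgebraic (R : realType) (n : nat) (X : set 'rV[R]_n) : Prop :=
  exists (k : nat) (l : nat -> nat) (A : nat -> nat -> set 'rV[R]_n),
    (forall i j, sign_set (A i j)) /\
    X = \bigcup_(i < k) \bigcap_(j < l i) A i j.

Definition zero_set (R : realType) (p : nat) (s : seq {mpoly R[p]}) :
    set 'rV[R]_p :=
  [set x | forall f, f \in s -> eval_at f x = 0].

Definition prod_set (R : realType) (p q : nat)
    (X : set 'rV[R]_p) (Y : set 'rV[R]_q) : set 'rV[R]_(p + q) :=
  [set z | X (lsubmx z) /\ Y (rsubmx z)].

Definition affine_map (R : realType) (p q : nat)
    (T : 'rV[R]_p -> 'rV[R]_q) : Prop :=
  exists (L : {linear 'rV[R]_p -> 'rV[R]_q}) (b : 'rV[R]_q),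
    forall x, T x = L x + b.

(* The index p ranges over positive integers: the component [S 0] is
   irrelevant and left unconstrained. *)
Record R_structure (R : realType) (S : forall p : nat, set (set 'rV[R]_p)) :
    Prop := RStructure {
  rs_zero_set : forall p (s : seq {mpoly R[p]}), (0 < p)%N -> S p (zero_set s);
  rs_halfspace : forall p (L : {scalar 'rV[R]_p}), (0 < p)%N ->
    S p [set x | 0 <= L x];
  rs_setU : forall p (X Y : set 'rV[R]_p), (0 < p)%N ->
    S p X -> S p Y -> S p (X `|` Y);
  rs_setI : forall p (X Y : set 'rV[R]_p), (0 < p)%N ->
    S p X -> S p Y -> S p (X `&` Y);
  rs_setC : forall p (X : set 'rV[R]_p), (0 < p)%N -> S p X -> S p (~` X);
  rs_prod : forall p q (X : set 'rV[R]_p) (Y : set 'rV[R]_q),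
    (0 < p)%N -> (0 < q)%N -> S p X -> S q Y -> S (p + q)%N (prod_set X Y);
  rs_affine : forall p q (T : 'rV[R]_p -> 'rV[R]_q) (X : set 'rV[R]_p),
    (0 < p)%N -> (0 < q)%N -> affine_map T -> S p X -> S q (T @` X)
}.

Definition point_or_interval (R : realType) (A : set 'rV[R]_1) : Prop :=
  (exists a : R, A = [set x | x 0 0 = a]) \/
  (exists a b : \bar R, (a < b)%E /\
     A = [set x | (a < (x 0 0)%:E)%E && ((x 0 0)%:E < b)%E]).

Definition tame_structure (R : realType)
    (S : forall p : nat, set (set 'rV[R]_p)) : Prop :=
  R_structure S /\
  forall X : set 'rV[R]_1, S 1%N X ->
    exists (k : nat) (A : nat -> set 'rV[R]_1),
      (forall i, point_or_interval (A i)) /\ X = \bigcup_(i < k) A i.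

Definition tame (R : realType) (p : nat) (X : set 'rV[R]_p) : Prop :=
  (0 < p)%N /\
  exists S : forall q : nat, set (set 'rV[R]_q), tame_structure S /\ S p X.

Definition sym_mx (R : realType) (m : nat) : Type :=
  {A : 'M[R]_m | A \is symmetricmx}.

Lemma gram_symmetric (R : realType) (m r : nat) (v : 'M[R]_(m, r)) :
  v *m v^T \is symmetricmx.
Proof.
by apply/is_hermitianmxP; rewrite expr0 scale1r map_mx_id // trmx_mul trmxK.
Qed.

Definition gram (R : realType) (m r : nat) (v : 'M[R]_(m, r)) : sym_mx R m :=
  exist _ (v *m v^T) (gram_symmetric v).

Definition polynomial_function (R : realType) (m : nat) (Q : sym_mx R m -> R) :
    Prop :=
  exists f : {mpoly R[m * m]},
    forall A : sym_mx R m, Q A = eval_at f (mxvec (sval A)).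

(* The matrix space is identified with row vectors by [mxvec] (row-major
   order); the value of the function is the last coordinate. *)
Definition graph (R : realType) (m r : nat) (F : 'M[R]_(m, r) -> R) :
    set 'rV[R]_(m * r + 1) :=
  [set row_mx (mxvec v) (F v)%:M | v in [set: 'M[R]_(m, r)]].

(* Main.v *)
From HB Require Import structures.
Require Import Defs.
From mathcomp Require Import all_boot all_order all_algebra.
From mathcomp Require Import reals.
From mathcomp Require Import mpoly boolp classical_sets constructive_ereal.
From mathcomp Require Import polyrcf qe_rcf_th.
From mathcomp Require ordered_qelim qe_rcf.

Set Implicit Arguments.
Unset Strict Implicit.
Unset Printing Implicit Defensive.

Import Order.TTheory GRing.Theory Num.Theory.

Local Open Scope ring_scope.
Local Open Scope classical_set_scope.

(** The graph of v |-> Q (v v^T) is the zero set of one polynomial: the entries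
    of v v^T are polynomials in those of v, so F(v) = Q (v v^T) is a polynomial
    function and its graph is {(v, t) | t - F(v) = 0}
    ([graph_semialgebraic]).

    Tameness of the graph holds because the semialgebraic sets are the
    definable sets of an o-minimal structure.  Here they are handled as the
    Boolean algebra generated by the sets {f > 0} ([constructible]), which makes
    the Boolean axioms immediate; products and the basic sets are obtained by
    substituting polynomials for the coordinates.  Two facts have content.

    - Stability under affine images.  The image of X by T is the projection of
      {(y, x) | x in X, y = T x}, so it suffices to project
      ([constructible_projection]); this is the Tarski-Seidenberg theorem.
      Constructible sets are exactly the sets defined by first-order formulas
      in the coordinates ([constructible_formula], [formula_constructible], the
      latter by quantifier elimination over real closed fields), and a
      projection is an existential quantification.

    - O-minimality.  By the intermediate value theorem the sign of a nonzero
      polynomial in one variable only changes at its finitely many roots.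
      Hence membership in a constructible subset of the line is constant on
      every segment that avoids some finite set
      ([constructible_finitely_broken]), and such a set is a union of points
      of the finite set and of gaps between them ([finitely_broken_union]). *)

(** * Polynomials and constructible sets *)

Module ord := ordered_qelim.ord.

(** Reduces statements about evaluation of polynomials to ring operations. *)
Lemma mpoly_ring_ind (n : nat) (K : nzRingType) (P : {mpoly K[n]} -> Prop) :
  (forall c, P c%:MP) -> (forall i, P 'X_i) ->
  (forall f g, P f -> P g -> P (f + g)) ->
  (forall f g, P f -> P g -> P (f * g)) ->
  forall f, P f.
Proof.
move=> PC PX PD PM; elim/mpolyind => [|c m f _ _ Pf].
  by rewrite -mpolyC0.
apply: PD => //; rewrite -mul_mpolyC; apply: (PM) => //.
rewrite mpolyXE_id; apply: (big_ind P) => [||i _]; [exact: PC 1|exact: PM|].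
elim: (m i) => [|k IHk]; first by rewrite expr0; apply: (PC 1).
by rewrite exprS; apply: PM.
Qed.

(** Positivity sets generate the semialgebraic sets as a Boolean algebra: the
    other sign conditions are Boolean combinations of conditions f > 0. *)
Inductive constructible (R : realType) (n : nat) : set 'rV[R]_n -> Prop :=
| constructible_gt0 (f : {mpoly R[n]}) :
    constructible [set x | 0 < eval_at f x]
| constructibleC (X : set 'rV[R]_n) : constructible X -> constructible (~` X)
| constructibleI (X Y : set 'rV[R]_n) :
    constructible X -> constructible Y -> constructible (X `&` Y).

Section Closure.

Variable R : realType.

Lemma constructibleU n (X Y : set 'rV[R]_n) :
  constructible X -> constructible Y -> constructible (X `|` Y).
Proof.
move=> cX cY; rewrite -[X `|` Y]setCK setCU.
by apply/constructibleC/constructibleI; apply: constructibleC.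
Qed.

Lemma constructible_ge0 n (f : {mpoly R[n]}) :
  constructible [set x | 0 <= eval_at f x].
Proof.
have -> : [set x | 0 <= eval_at f x] = ~` [set x | 0 < eval_at (- f) x].
  by apply/seteqP; split=> x /=; rewrite /eval_at mevalN oppr_gt0 leNgt => /negP.
exact/constructibleC/constructible_gt0.
Qed.

Lemma constructible_eq0 n (f : {mpoly R[n]}) :
  constructible [set x | eval_at f x = 0].
Proof.
have -> : [set x | eval_at f x = 0] =
    [set x | 0 <= eval_at f x] `&` [set x | 0 <= eval_at (- f) x].
  apply/seteqP; split=> x; rewrite /= /eval_at mevalN oppr_ge0.
    by move=> ->; rewrite lexx.
  by case=> f_ge0 f_le0; apply/eqP; rewrite eq_le f_le0.
by apply: constructibleI; apply: constructible_ge0.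
Qed.

Lemma constructibleT n : constructible [set: 'rV[R]_n].
Proof.
have -> : [set: 'rV[R]_n] = [set x | 0 <= eval_at 0 x].
  by apply/seteqP; split=> x //= _; rewrite /eval_at meval0.
exact: constructible_ge0.
Qed.

Lemma constructible0 n : constructible (set0 : set 'rV[R]_n).
Proof. by rewrite -setCT; apply/constructibleC/constructibleT. Qed.

Lemma constructible_zero_set n (s : seq {mpoly R[n]}) :
  constructible (zero_set s).
Proof.
elim: s => [|f s IHs].
  have -> : zero_set [::] = [set: 'rV[R]_n] by apply/seteqP; split.
  exact: constructibleT.
have -> : zero_set (f :: s) = [set x | eval_at f x = 0] `&` zero_set s.
  apply/seteqP; split=> x /= => [fs0|[f0 s0] g].
    by split=> [|g gs]; apply: fs0; rewrite inE ?eqxx ?gs ?orbT.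
  by rewrite inE => /orP[/eqP->|/s0].
by apply: constructibleI => //; apply: constructible_eq0.
Qed.

Lemma semialgebraic_constructible n (X : set 'rV[R]_n) :
  semialgebraic X -> constructible X.
Proof.
move=> [k [l [A [signA ->]]]].
rewrite bigcup_mkord; apply: (big_ind (@constructible R n)) => [|Y Z|i _].
- exact: constructible0.
- exact: constructibleU.
rewrite bigcap_mkord; apply: (big_ind (@constructible R n)) => [|Y Z|j _].
- exact: constructibleT.
- exact: constructibleI.
have [f [] ->] := signA i j; first exact: constructible_gt0.
  have -> : [set x | eval_at f x < 0] = [set x | 0 < eval_at (- f) x].
    by apply/seteqP; split=> x /=; rewrite /eval_at mevalN oppr_gt0.
  exact: constructible_gt0.
exact: constructible_eq0.
Qed.

(** A positivity set pulls back to the positivity set of the composite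
    polynomial, and preimages commute with the Boolean operations. *)
Lemma constructible_preimage n p (g : 'I_p -> {mpoly R[n]}) (X : set 'rV[R]_p) :
  constructible X -> constructible [set x | X (\row_j eval_at (g j) x)].
Proof.
elim=> [f|Y _ cY|Y Z _ cY _ cZ].
- have -> : [set x | [set y | 0 < eval_at f y] (\row_j eval_at (g j) x)] =
      [set x | 0 < eval_at (f \mPo [tuple g j | j < p]) x].
    have E x : eval_at (f \mPo [tuple g j | j < p]) x =
               eval_at f (\row_j eval_at (g j) x).
      rewrite /eval_at comp_mpoly_meval; apply: meval_eq => j.
      by rewrite tnth_mktuple mxE.
    by apply/seteqP; split=> x /=; rewrite E.
  exact: constructible_gt0.
- exact: constructibleC cY.
- exact: constructibleI cY cZ.
Qed.

Lemma constructible_prod p q (X : set 'rV[R]_p) (Y : set 'rV[R]_q) :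
  constructible X -> constructible Y -> constructible (prod_set X Y).
Proof.
move=> cX cY; apply: constructibleI.
  have := constructible_preimage (fun j => 'X_(lshift q j)) cX.
  congr constructible; apply/funext => z; congr X.
  by apply/rowP => j; rewrite !mxE /eval_at mevalXU.
have := constructible_preimage (fun j => 'X_(rshift p j)) cY.
congr constructible; apply/funext => z; congr Y.
by apply/rowP => j; rewrite !mxE /eval_at mevalXU.
Qed.

Lemma scalar_mpoly p (L : {scalar 'rV[R]_p}) :
  exists f : {mpoly R[p]}, forall x, eval_at f x = L x.
Proof.
exists (\sum_i (L 'e_i)%:MP * 'X_i) => x.
rewrite {2}(row_sum_delta x) linear_sum /eval_at raddf_sum /=.
by apply: eq_bigr => i _; rewrite mevalM mevalC mevalXU linearZ mulrC.
Qed.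

End Closure.

(** * Projections and affine images *)

Section Projection.

Variable R : realType.

(** The first-order formulas of the quantifier elimination procedure are
    interpreted in environments that are sequences. *)
Definition coords n (x : 'rV[R]_n) : seq R := [seq x 0 i | i <- enum 'I_n].

Lemma size_coords n (x : 'rV[R]_n) : size (coords x) = n.
Proof. by rewrite size_map size_enum_ord. Qed.

Lemma nth_coords n (x : 'rV[R]_n) (i : 'I_n) : (coords x)`_i = x 0 i.
Proof. by rewrite (nth_map i) ?size_enum_ord // nth_ord_enum. Qed.

Lemma coords_row n (s : seq R) :
  size s = n -> coords (\row_(i < n) s`_i) = s.
Proof.
move=> sz; apply: (@eq_from_nth _ 0); rewrite size_coords ?sz // => i lti.
by rewrite (nth_coords _ (Ordinal lti)) mxE.
Qed.

Lemma coords_row_mx q p (y : 'rV[R]_q) (x : 'rV[R]_p) :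
  coords (row_mx y x) = coords y ++ coords x.
Proof.
apply: (@eq_from_nth _ 0); rewrite ?size_cat !size_coords // => i lti.
rewrite (nth_coords _ (Ordinal lti)) nth_cat size_coords mxE.
case: splitP => j /= ->; first by rewrite ltn_ord nth_coords.
by rewrite ltnNge leq_addr /= addKn nth_coords.
Qed.

Lemma mpoly_term n (f : {mpoly R[n]}) :
  exists t : GRing.term R, forall x, GRing.eval (coords x) t = eval_at f x.
Proof.
rewrite /eval_at.
elim/mpoly_ring_ind: f => [c|i|f g [t Et] [u Eu]|f g [t Et] [u Eu]].
- by exists (GRing.Const c) => x; rewrite mevalC.
- by exists (GRing.Var _ i) => x; rewrite mevalXU /= nth_coords.
- by exists (GRing.Add t u) => x; rewrite mevalD /= Et Eu.
- by exists (GRing.Mul t u) => x; rewrite mevalM /= Et Eu.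
Qed.

Lemma term_mpoly n (t : GRing.term R) : GRing.rterm t ->
  exists f : {mpoly R[n]}, forall x, GRing.eval (coords x) t = eval_at f x.
Proof.
rewrite /eval_at.
elim: t => //= [i _|c _|k _|t IHt u IHu /andP[/IHt[f Ef] /IHu[g Eg]]
  |t IHt /IHt[f Ef]|t IHt k /IHt[f Ef]
  |t IHt u IHu /andP[/IHt[f Ef] /IHu[g Eg]]|t IHt k /IHt[f Ef]].
- have [lti|gei] := ltnP i n.
    exists 'X_(Ordinal lti) => x.
    by rewrite mevalXU (nth_coords x (Ordinal lti)).
  (* Variables beyond the environment evaluate to the default value 0. *)
  by exists 0 => x; rewrite meval0 nth_default ?size_coords.
- by exists c%:MP => x; rewrite mevalC.
- by exists k%:R => x; rewrite rmorph_nat.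
- by exists (f + g) => x; rewrite mevalD Ef Eg.
- by exists (- f) => x; rewrite mevalN Ef.
- by exists (f *+ k) => x; rewrite mevalMn Ef.
- by exists (f * g) => x; rewrite mevalM Ef Eg.
- by exists (f ^+ k) => x; rewrite rmorphXn /= Ef.
Qed.

Lemma constructible_formula n (X : set 'rV[R]_n) : constructible X ->
  exists F : ord.formula R, forall x, X x <-> ord.holds (coords x) F.
Proof.
elim=> [f|Y _ [F EF]|Y Z _ [F EF] _ [G EG]].
- have [t Et] := mpoly_term f.
  by exists (ord.Lt (GRing.NatConst _ 0) t) => x /=; rewrite Et.
- by exists (ord.Not F) => x /=; rewrite -EF.
- by exists (ord.And F G) => x /=; rewrite -EF -EG.
Qed.

Lemma qf_constructible n (F : ord.formula R) :
  ord.qf_form F -> ord.rformula F ->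
  constructible [set x : 'rV[R]_n | ord.holds (coords x) F].
Proof.
elim: F => //=.
- move=> [] _ _.
    have := constructibleT R n; congr constructible.
    by apply/seteqP; split.
  have := constructible0 R n; congr constructible.
  by apply/seteqP; split.
- move=> t u _ /andP[/(term_mpoly n)[f Ef] /(term_mpoly n)[g Eg]].
  have := constructible_eq0 (f - g); congr constructible; apply/funext => x /=.
  rewrite Ef Eg /eval_at mevalB; apply/propext.
  by split=> [/eqP|->]; rewrite ?subrr // subr_eq0 => /eqP.
- move=> t u _ /andP[/(term_mpoly n)[f Ef] /(term_mpoly n)[g Eg]].
  have := constructible_gt0 (g - f); congr constructible; apply/funext => x /=.
  by rewrite Ef Eg /eval_at mevalB subr_gt0.
- move=> t u _ /andP[/(term_mpoly n)[f Ef] /(term_mpoly n)[g Eg]].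
  have := constructible_ge0 (g - f); congr constructible; apply/funext => x /=.
  by rewrite Ef Eg /eval_at mevalB subr_ge0.
- move=> F IHF G IHG /andP[qF qG] /andP[rF rG].
  by apply: constructibleI; [apply: IHF | apply: IHG].
- move=> F IHF G IHG /andP[qF qG] /andP[rF rG].
  by apply: constructibleU; [apply: IHF | apply: IHG].
- move=> F IHF G IHG /andP[qF qG] /andP[rF rG].
  have := constructibleU (constructibleC (IHF qF rF)) (IHG qG rG).
  congr constructible; apply/funext => x /=; apply/propext; split.
    by case.
  by move=> FG; have [/FG|] := pselect (ord.holds (coords x) F); [right|left].
- by move=> F IHF qF rF; apply: constructibleC; apply: IHF.
Qed.

(** Quantifier elimination produces an equivalent formula without quantifiers
    or inverses, which is a Boolean combination of polynomial inequalities. *)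
Lemma formula_constructible n (F : ord.formula R) :
  constructible [set x : 'rV[R]_n | ord.holds (coords x) F].
Proof.
pose wproj i oc : ord.formula R := 
    qe_rcf.qfr_to_formula (@qe_rcf.wproj R i oc).
pose G := ord.quantifier_elim wproj (ord.to_rform F).
have /andP[qG rG] : ord.qf_form G && ord.rformula G.
  apply: ord.quantifier_elim_wf; last exact: ord.to_rform_rformula.
  exact: qe_rcf.wf_QE_wproj.
have := qf_constructible n qG rG.
congr constructible; apply/funext => x /=; apply/propext.
split=> [/(ord.qf_evalP _ qG) Gx|Fx].
  exact/qe_rcf.rcf_satP.
by apply/(ord.qf_evalP _ qG)/qe_rcf.rcf_satP.
Qed.

(** Quantifying the variable whose index is the length of the environment
    appends a value to it, so that successive quantifiers append a sequence. *)
Lemma holds_exists (q p : nat) (e : seq R) (F : ord.formula R) : size e = q ->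
  ord.holds e (foldr ord.Exists F (iota q p)) <->
  exists2 s, size s = p & ord.holds (e ++ s) F.
Proof.
move=> <- {q}; elim: p e => [|p IHp] e /=.
  split=> [Fe|[s /size0nil->]]; last by rewrite cats0.
  by exists [::]; rewrite ?cats0.
have IH x : ord.holds (set_nth 0 e (size e) x)
    (foldr ord.Exists F (iota (size e).+1 p)) <->
    exists2 s, size s = p & ord.holds (e ++ x :: s) F.
  rewrite set_nthE ltnn subnn /= cats1 -(size_rcons e x) IHp.
  by split=> -[s sz Fs]; exists s; rewrite ?cat_rcons // -cat_rcons.
split=> [[x /IH[s sz Fs]]|[[//|x s] [sz] Fs]].
  by exists (x :: s); rewrite //= sz.
by exists x; apply/IH; exists s.
Qed.

(** Tarski-Seidenberg: the projected coordinates are the last p variables of a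
    formula for X, and they get quantified existentially. *)
Theorem constructible_projection q p (X : set 'rV[R]_(q + p)) :
  constructible X -> constructible [set y | exists x, X (row_mx y x)].
Proof.
move=> /constructible_formula[F EF].
have := formula_constructible q (foldr ord.Exists F (iota q p)).
congr constructible; apply/funext => y /=; apply/propext.
rewrite (holds_exists _ _ (size_coords y)); split=> [[s sz Fs]|[x Xx]].
  by exists (\row_i s`_i); apply/EF; rewrite coords_row_mx coords_row.
by exists (coords x); rewrite ?size_coords // -coords_row_mx; apply/EF.
Qed.

(** The image is the projection to the first factor of the transposed graph of
    the restriction of T to X. *)
Lemma constructible_affine p q (T : 'rV[R]_p -> 'rV[R]_q) (X : set 'rV[R]_p) :
  affine_map T -> constructible X -> constructible (T @` X).
Proof.
move=> [L [b TE]] cX.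
have /choice[g gE] : forall j, exists f : {mpoly R[p]},
    forall x, eval_at f x = T x 0 j.
  move=> j; pose Lj : 'rV[R]_p -> R := fun x => L x 0 j.
  have Lj_lin : scalar Lj by move=> a x y; rewrite /Lj linearP !mxE.
  have [f Ef] :=
    scalar_mpoly (HB.pack Lj (GRing.isLinear.Build _ _ _ _ _ Lj_lin)).
  exists (f + (b 0 j)%:MP) => x.
  by rewrite TE mxE /eval_at mevalD mevalC -/(eval_at f x) Ef.
pose h j : {mpoly R[q + p]} := 'X_(lshift p j) -
  (g j \mPo [tuple 'X_(rshift q i) | i < p]).
have hE j y x : eval_at (h j) (row_mx y x) = y 0 j - T x 0 j.
  rewrite /eval_at mevalB mevalXU row_mxEl comp_mpoly_meval -gE.
  congr (_ - _); apply: meval_eq => i.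
  by rewrite tnth_mktuple mevalXU row_mxEr.
have := constructible_projection (constructibleI
  (constructible_prod (constructibleT R q) cX)
  (constructible_zero_set [seq h j | j <- enum 'I_q])).
congr constructible; apply/seteqP; split=> y /=.
  move=> [x [[_]]]; rewrite row_mxKr => Xx h0; exists x => //.
  apply/rowP => j; apply/esym/eqP; rewrite -subr_eq0 -hE h0 //.
  by rewrite map_f ?mem_enum.
move=> [x Xx <-]; exists x; split; first by rewrite /prod_set /= row_mxKr.
by move=> f /mapP[j _ ->]; rewrite hE subrr.
Qed.

End Projection.

(** * O-minimality *)

Section Line.

Variable R : realType.

(** Unlike an explicit list of points and intervals, this description of a
    finite union of points and intervals is visibly stable under Boolean
    operations: it suffices to concatenate the lists of breakpoints. *)
Definition finitely_broken (P : R -> Prop) : Prop :=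
  exists s : seq R, forall x y, x <= y ->
    (forall t, t \in s -> ~~ (x <= t <= y)) -> (P x <-> P y).

(** The breakpoints are the roots: two values of opposite signs would enclose a
    root, by the intermediate value theorem. *)
Lemma poly_finitely_broken (p : {poly R}) :
  finitely_broken (fun x => 0 < p.[x]).
Proof.
have [->|p_neq0] := eqVneq p 0.
  by exists [::] => x y _ _; rewrite !horner0.
exists (rootsR p) => x y lexy no_root.
have {}no_root t : x <= t <= y -> ~~ root p t.
  move=> xty; apply/negP => rt.
  have /no_root : t \in rootsR p.
    by rewrite -(roots_on_rootsR p_neq0) rt andbT in_itv.
  by rewrite xty.
have same_sign : 0 < p.[x] * p.[y].
  rewrite ltNge; apply/negP => /(polyrcf.poly_ivt lexy)[t xty].
  by apply/negP/no_root; rewrite in_itv /= in xty.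
by split=> p_gt0; [rewrite -(pmulr_rgt0 _ p_gt0) | rewrite -(pmulr_lgt0 _ p_gt0)].
Qed.

Lemma mpoly_horner (f : {mpoly R[1]}) :
  exists p : {poly R}, forall x, eval_at f x = p.[x 0 0].
Proof.
rewrite /eval_at.
elim/mpoly_ring_ind: f => [c|i|f g [p Ep] [u Eu]|f g [p Ep] [u Eu]].
- by exists c%:P => x; rewrite mevalC hornerC.
- by exists 'X => x; rewrite mevalXU hornerX (ord1 i).
- by exists (p + u) => x; rewrite mevalD hornerD Ep Eu.
- by exists (p * u) => x; rewrite mevalM hornerM Ep Eu.
Qed.

Lemma constructible_finitely_broken (X : set 'rV[R]_1) :
  constructible X -> finitely_broken (fun a => X a%:M).
Proof.
elim=> [f|Y _ [s sY]|Y Z _ [s sY] _ [s' sZ]].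
- have [p Ep] := mpoly_horner f.
  have [s ps] := poly_finitely_broken p; exists s => x y lexy ns.
  by rewrite /= !Ep !mxE; apply: ps.
- by exists s => x y lexy ns; split=> NY /(sY x y lexy ns).
- exists (s ++ s') => x y lexy ns; rewrite /setI /=.
  have -> : Y x%:M <-> Y y%:M.
    by apply: sY => // t ts; apply: ns; rewrite mem_cat ts.
  have -> : Z x%:M <-> Z y%:M.
    by apply: sZ => // t ts; apply: ns; rewrite mem_cat ts orbT.
  by [].
Qed.

(** Adding a breakpoint to the list can only shrink the gap around x, by
    replacing the endpoint that lies on the same side of x. *)
Lemma gap_around (s : seq R) (x : R) : x \notin s ->
  exists a b : \bar R,
    [/\ a \in [:: -oo%E, +oo%E & [seq t%:E | t <- s]],
        b \in [:: -oo%E, +oo%E & [seq t%:E | t <- s]],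
        (a < x%:E < b)%E &
        forall t, t \in s -> ~~ (a < t%:E < b)%E].
Proof.
elim: s => [_|u s IHs].
  by exists -oo%E, +oo%E; split; rewrite ?inE ?eqxx ?orbT ?ltNyr ?ltry.
rewrite inE negb_or => /andP[xu /IHs[a [b [Ea Eb /andP[ax xb] gap]]]].
have E c : c \in [:: -oo%E, +oo%E & [seq t%:E | t <- s]] ->
    c \in [:: -oo%E, +oo%E & [seq t%:E | t <- u :: s]].
  by rewrite !inE => /or3P[->|->|->]; rewrite ?orbT.
have Eu : u%:E \in [:: -oo%E, +oo%E & [seq t%:E | t <- u :: s]].
  by rewrite !inE eqxx !orbT.
have [/andP[au ub]|nu] := boolP (a < u%:E < b)%E; last first.
  exists a, b; split; rewrite ?E ?ax //.
  by move=> t; rewrite inE => /orP[/eqP->|/gap].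
case: (ltgtP x u) xu => // [xu|ux] _.
  exists a, u%:E; split; rewrite ?Eu ?E // ?ax ?lte_fin //.
  move=> t; rewrite inE => /orP[/eqP->|/gap]; first by rewrite ltxx andbF.
  by apply: contra => /andP[-> /lt_trans]; apply.
exists u%:E, b; split; rewrite ?Eu ?E // ?xb ?lte_fin ?ux //.
move=> t; rewrite inE => /orP[/eqP->|/gap]; first by rewrite ltxx.
by apply: contra => /andP[/(lt_trans au)-> ->].
Qed.

(** The pieces are the breakpoints that lie in X, and the open intervals
    included in X whose endpoints are breakpoints or infinite.  They cover X
    since X contains the whole gap around any of its other points. *)
Lemma finitely_broken_union (X : set 'rV[R]_1) :
  finitely_broken (fun a => X a%:M) ->
  exists (k : nat) (A : nat -> set 'rV[R]_1),
    (forall i, point_or_interval (A i)) /\ X = \bigcup_(i < k) A i.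
Proof.
move=> [s sX].
have XE (x : 'rV[R]_1) : X x <-> X (x 0 0)%:M by rewrite -mx11_scalar.
pose E : seq (\bar R) := [:: -oo%E, +oo%E & [seq t%:E | t <- s]].
pose ends : seq (\bar R * \bar R) := [seq ab <- [seq (a, b) | a <- E, b <- E] |
  (ab.1 < ab.2)%E && `[< forall y, (ab.1 < y%:E < ab.2)%E -> X y%:M >]].
pose pieces : seq (R + \bar R * \bar R) :=
  [seq inl a | a <- [seq a <- s | `[< X a%:M >]]] ++ [seq inr ab | ab <- ends].
pose piece (c : R + \bar R * \bar R) : set 'rV[R]_1 := match c with
  | inl a => [set x | x 0 0 = a]
  | inr ab => [set x | (ab.1 < (x 0 0)%:E)%E && ((x 0 0)%:E < ab.2)%E]
  end.
(* The default piece [inl 0] is a point, so that the family consists of points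
   and intervals even beyond the end of the list. *)
exists (size pieces), (fun i => piece (nth (inl 0) pieces i)); split=> [i|].
  have [lti|gei] := ltnP i (size pieces); last first.
    by rewrite nth_default //; left; exists 0.
  move: (mem_nth (inl 0) lti); rewrite mem_cat => /orP[/mapP[a _ ->]|].
    by left; exists a.
  move=> /mapP[[a b]]; rewrite mem_filter => /andP[/andP[ltab _] _] ->.
  by right; exists a, b.
apply/seteqP; split=> x.
  move=> /XE Xx; suff [c cin xc] : exists2 c, c \in pieces & piece c x.
    have /(nthP (inl 0))[i lti ci] := cin.
    by exists i => //; rewrite ci.
  have [xs|xs] := boolP (x 0 0 \in s).
    exists (inl (x 0 0)) => //; rewrite mem_cat map_f // mem_filter xs andbT.
    exact/asboolP.
  have [a [b [Ea Eb axb gap]]] := gap_around xs.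
  exists (inr (a, b)) => //; rewrite mem_cat map_f ?orbT // mem_filter.
  rewrite allpairs_f // andbT /=.
  have [ax xb] := andP axb; rewrite (lt_trans ax xb) /=.
  apply/asboolP => y /andP[ay yb].
  have [lexy|/ltW leyx] := leP (x 0 0) y.
    apply/(sX _ _ lexy) => // t /gap; apply: contra => /andP[xt ty].
    by rewrite (lt_le_trans ax) ?lee_fin //= (le_lt_trans _ yb) ?lee_fin.
  apply/(sX _ _ leyx) => // t /gap; apply: contra => /andP[yt tx].
  by rewrite (lt_le_trans ay) ?lee_fin //= (le_lt_trans _ xb) ?lee_fin.
move=> [i lti]; apply: contraPP => nXx /=.
have := mem_nth (inl 0) lti; rewrite mem_cat => /orP[/mapP[a]|/mapP[[a b]]].
  rewrite mem_filter => /andP[/asboolP Xa _] -> /= xa.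
  by apply: nXx; apply/XE; rewrite xa.
rewrite mem_filter => /andP[/andP[_ /asboolP Xab] _] -> /= axb.
by apply/nXx/XE/Xab.
Qed.

End Line.

(** * Tameness of semialgebraic sets and the graph *)

Theorem constructible_tame_structure (R : realType) :
  tame_structure (@constructible R).
Proof.
split=> [|X cX]; last exact/finitely_broken_union/constructible_finitely_broken.
split=> [p s _|p L _|p X Y _|p X Y _|p X _|p q X Y _ _|p q T X _ _].
- exact: constructible_zero_set.
- have [f Ef] := scalar_mpoly L.
  have := constructible_ge0 f; congr constructible.
  by apply/funext => x /=; rewrite Ef.
- exact: constructibleU.
- exact: constructibleI.
- exact: constructibleC.
- exact: constructible_prod.
- exact: constructible_affine.
Qed.

Theorem semialgebraic_tame (R : realType) (p : nat) (X : set 'rV[R]_p) :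
  (0 < p)%N -> semialgebraic X -> tame X.
Proof.
move=> p_gt0 sX; split=> //; exists (@constructible R); split.
  exact: constructible_tame_structure.
exact: semialgebraic_constructible.
Qed.

Lemma zero_set_semialgebraic (R : realType) (n : nat) (f : {mpoly R[n]}) :
  semialgebraic [set x | eval_at f x = 0].
Proof.
exists 1%N, (fun=> 1%N), (fun _ _ => [set x | eval_at f x = 0]); split.
  by move=> _ _; exists f; apply: Or33.
by rewrite !II1 bigcup_set1 bigcap_set1.
Qed.

(** The equation of the graph is t = f (V V^T), for V the matrix of variables. *)
Lemma graph_semialgebraic (R : realType) (m r : nat) (Q : sym_mx R m -> R) :
  polynomial_function Q ->
  semialgebraic (graph (fun v : 'M[R]_(m, r) => Q (gram v))).
Proof.
move=> [f Qf].
pose V : 'M[{mpoly R[m * r + 1]}]_(m, r) :=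
  \matrix_(i, k) 'X_(lshift 1 (mxvec_index i k)).
pose g : {mpoly R[m * r + 1]} :=
  f \mPo [tuple mxvec (V *m V^T) 0 l | l < m * m].
have gE (v : 'M[R]_(m, r)) (c : 'M[R]_1) :
    eval_at g (row_mx (mxvec v) c) = Q (gram v).
  set z := row_mx _ _; have Vz : map_mx (meval (fun i => z 0 i)) V = v.
    by apply/matrixP => i k; rewrite !mxE mevalXU row_mxEl mxvecE.
  rewrite Qf /eval_at comp_mpoly_meval; apply: meval_eq => l.
  by rewrite tnth_mktuple /= -[in RHS]Vz map_trmx -map_mxM -map_mxvec [RHS]mxE.
have := zero_set_semialgebraic ('X_(rshift (m * r) ord0) - g).
congr semialgebraic; apply/seteqP; split=> z /=.
  rewrite /eval_at mevalB mevalXU => /eqP; rewrite subr_eq0 => /eqP zg.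
  exists (vec_mx (lsubmx z)) => //; rewrite -(gE _ (rsubmx z)) vec_mxK hsubmxK.
  by rewrite /eval_at -zg -[RHS]hsubmxK (mx11_scalar (rsubmx z)) mxE.
move=> [v _ <-]; rewrite /eval_at mevalB mevalXU row_mxEr mxE eqxx mulr1n.
by have := gE v (Q (gram v))%:M; rewrite /eval_at => ->; rewrite subrr.
Qed.

Theorem proposition25 (R : realType) (m r : nat) (hm : (0 < m)%N) (hr : (0 < r)%N)
    (Q : sym_mx R m -> R) (hQ : polynomial_function Q) :
  semialgebraic (graph (fun v : 'M[R]_(m, r) => Q (gram v))) /\
  tame (graph (fun v : 'M[R]_(m, r) => Q (gram v))).
Proof.
have sG := graph_semialgebraic r hQ.
by split=> //; apply: semialgebraic_tame; rewrite ?addn1.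
Qed.
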